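(* There exists a separable abelian metric group $(\mathbb{G},d)$, where $d$ is an invariant metric, such that for every separable abelian metric group $(H,p)$ with $p$ an invariant metric there are a subgroup $H'\leq \mathbb{G}$ and an isometric group isomorphism $\iota:H\to H'$ (where $H'$ carries the restriction of $d$).
   Context: A metric group is a group equipped with a metric such that the group operations are continuous in the topology given by the metric. A metric $d$ on an abelian group $G$ (written additively) is invariant if $d(x+z,y+z)=d(x,y)$ for all $x,y,z\in G$. No completeness is assumed. *)

(* Defs.v *)
From HB Require Import structures.
From mathcomp Require Import all_boot all_order all_algebra.
From mathcomp Require Import all_classical all_reals all_analysis.

Set Implicit Arguments.
Unset Strict Implicit.
Unset Printing Implicit Defensive.

Import Order.TTheory GRing.Theory Num.Theory.

Local Open Scope classical_set_scope.
Local Open Scope ring_scope.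

Definition is_metric (R : realType) (T : Type) (d : T -> T -> R) : Prop :=
  [/\ forall x y, 0 <= d x y,
      forall x y, d x y = 0 <-> x = y,
      forall x y, d x y = d y x
    & forall x y z, d x z <= d x y + d y z].

Definition induces_topology (R : realType) (T : topologicalType)
    (d : T -> T -> R) : Prop :=
  forall x : T, nbhs x = nbhs_ball_ (fun y e => [set z | d y z < e]) x.

(* Hierarchy-Builder rejects the join of TopologicalZmodule and Metric (its
   intersection with PseudoMetricNormedZmod has no structure of its own), so the
   distance is a separate argument instead of the mdist of a metricType.
   Continuity of + and - is part of topologicalZmodType, whose topology must be
   that of d. *)
Definition metric_group (R : realType) (G : topologicalZmodType)
    (d : G -> G -> R) : Prop :=
  is_metric d /\ induces_topology d.

Definition invariant (R : realType) (G : zmodType) (d : G -> G -> R) : Prop :=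
  forall x y z : G, d (x + z) (y + z) = d x y.

Definition separable_space (T : topologicalType) : Prop :=
  exists2 S : set T, countable S & dense S.

Definition separable_invariant_metric_group (R : realType)
    (G : topologicalZmodType) (d : G -> G -> R) : Prop :=
  [/\ metric_group d, invariant d & separable_space G].

Definition isometric (R : realType) (X Y : Type) (p : X -> X -> R)
    (d : Y -> Y -> R) (f : X -> Y) : Prop :=
  forall x y : X, d (f x) (f y) = p x y.

(* An isomorphism H -> H' is given as its composite iota with the inclusion of
   H' in G; d on the image of iota is the restriction of d to H'. *)
Definition isometric_isomorphism_onto (R : realType) (H G : zmodType)
    (p : H -> H -> R) (d : G -> G -> R) (H' : zmodClosed G)
    (iota : {additive H -> G}) : Prop :=
  set_bij [set: H] [set x | x \in H'] iota /\ isometric p d iota.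

(* Main.v *)
Require Import Defs.
From HB Require Import structures.
From mathcomp Require Import all_boot all_order all_algebra.
From mathcomp Require Import all_classical all_reals all_analysis.
From mathcomp Require Import ring lra ring_quotient.

Set Implicit Arguments.
Unset Strict Implicit.
Unset Printing Implicit Defensive.

Import Order.TTheory GRing.Theory Num.Theory.
Import numFieldNormedType.Exports.

Local Open Scope classical_set_scope.
Local Open Scope ring_scope.

(** An invariant metric on an abelian group amounts to a function N with
    N (x - y) <= N x + N y.  A separable group H has a dense subgroup that is
    the image of F = Z[X], the free abelian group on the X^i, under a
    homomorphism for which the pulled-back seminorm is at most
    B x = sum_i |x_i| (i + 1).  Modulo errors eps W with
    W x = sum_i |x_i| (i + 1)^2, such seminorms form a separable family (D_n).
    Take a countable tree in which each node carries a copy of F with one of the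
    D_n and has a child for every n and every level k; the copies at the ends of
    an edge of level k are glued up to an error 2^(1-k) W whenever their
    seminorms are that close.  The amalgamated seminorm lives on the countable
    group F[X]; its completion G is universal, because a seminorm N coming from
    H is the limit of the seminorms along a branch, and the copies of each x in
    F along that branch converge in G to the image of x. *)

Lemma subrBB (V : zmodType) (x y a b : V) : x - y - (a - b) = x - a - (y - b).
Proof. by rewrite !opprB addrACA [- y - a]addrC -addrACA. Qed.

(** * Seminorms on abelian groups *)

Section Seminorm.
Variables (R : realType) (V : zmodType).
Implicit Types (N : V -> R) (x y z : V).

(** The inequality for differences packs three axioms into one: [y = x] gives nonnegativity, [x = 0]
    gives symmetry, and the two together give the triangle inequality. *)
Definition seminorm N := N 0 = 0 /\ forall x y, N (x - y) <= N x + N y.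

Variables (N : V -> R) (sN : seminorm N).

Lemma seminorm0 : N 0 = 0. Proof. by case: sN. Qed.

Lemma seminormB x y : N (x - y) <= N x + N y. Proof. by case: sN. Qed.

Lemma seminorm_ge0 x : 0 <= N x.
Proof. by have := seminormB x x; rewrite subrr seminorm0; lra. Qed.

Lemma seminormN x : N (- x) = N x.
Proof.
have h y : N (- y) <= N y by have := seminormB 0 y; rewrite sub0r seminorm0 add0r.
by apply/le_anti; rewrite h -{1}[x]opprK h.
Qed.

Lemma seminormD x y : N (x + y) <= N x + N y.
Proof. by have := seminormB x (- y); rewrite opprK seminormN. Qed.

Lemma seminormC x y : N (x - y) = N (y - x).
Proof. by rewrite -seminormN opprB. Qed.

Lemma seminorm_triangle y x z : N (x - z) <= N (x - y) + N (y - z).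
Proof. by rewrite -(subrKA y x (- z)) seminormD. Qed.

Lemma seminorm_dist x y : `|N x - N y| <= N (x - y).
Proof.
have h a b : N a - N b <= N (a - b).
  by have := seminormD (a - b) b; rewrite subrK; lra.
by rewrite ler_norml (h x y) andbT; have := h y x; rewrite seminormC; lra.
Qed.

Lemma seminormMn x n : N (x *+ n) <= N x *+ n.
Proof.
elim: n => [|n IH]; first by rewrite !mulr0n seminorm0.
by rewrite !mulrS (le_trans (seminormD _ _)) // lerD2l.
Qed.

Lemma seminormMz x (m : int) : N (x *~ m) <= N x * `|m|%:~R.
Proof.
case: (intP m) => [|n|n].
- by rewrite mulr0z seminorm0 normr0 mulr0.
- by rewrite -pmulrn; have /le_trans := seminormMn x n.+1; apply; rewrite mulr_natr.
- rewrite mulrNz seminormN normrN -pmulrn.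
  by have /le_trans := seminormMn x n.+1; apply; rewrite mulr_natr.
Qed.

Lemma seminorm_sum (I : Type) (r : seq I) (P : pred I) (F : I -> V) :
  N (\sum_(i <- r | P i) F i) <= \sum_(i <- r | P i) N (F i).
Proof.
elim/big_ind2: _ => [|x a y b ha hb|//]; first by rewrite seminorm0.
by rewrite (le_trans (seminormD _ _)) // lerD.
Qed.

End Seminorm.

(** * The metric group of a norm *)

Section NormTopology.
Variables (R : realType) (V : zmodType) (N : V -> R).

Definition is_norm := seminorm N /\ forall x, N x = 0 -> x = 0.

(** An alias of [V] that remembers the proof of [is_norm], so that the topology attached to the type
    can depend on [N]. *)
Definition norm_group of is_norm : Type := V.

Variable nN : is_norm.
Local Notation G := (norm_group nN).
HB.instance Definition _ := GRing.Zmodule.on G.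

Definition norm_nbhs (x : G) : set_system G :=
  nbhs_ball_ (fun (y : G) e => [set z | N (y - z) < e]) x.
HB.instance Definition _ := hasNbhs.Build G norm_nbhs.

Let sN : seminorm N := nN.1.

Lemma norm_nbhs_filter (x : G) : ProperFilter (nbhs x).
Proof.
apply: Build_ProperFilter_ex.
  by move=> P [e /= e0 eP]; exists x; apply: eP; rewrite /= subrr (seminorm0 sN).
split; first by exists 1 => //=.
- move=> P Q [e /= e0 eP] [f /= f0 fQ]; exists (Num.min e f) => /=.
    by rewrite lt_min e0.
  by move=> z /=; rewrite lt_min => /andP[ze zf]; split; [apply: eP|apply: fQ].
- by move=> P Q PQ [e /= e0 eP]; exists e => //= z /eP /PQ.
Qed.

Lemma norm_nbhs_singleton (x : G) (A : set G) : nbhs x A -> A x.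
Proof. by move=> [e /= e0]; apply; rewrite /= subrr (seminorm0 sN). Qed.

Lemma norm_nbhs_nbhs (x : G) (A : set G) : nbhs x A -> nbhs x (nbhs^~ A).
Proof.
move=> [e /= e0 eA]; exists (e / 2) => /=; first by lra.
move=> y /= xy; exists (e / 2) => /=; first by lra.
by move=> z /= yz; apply: eA => /=; have := seminorm_triangle sN y x z; lra.
Qed.

HB.instance Definition _ := Nbhs_isNbhsTopological.Build G
  norm_nbhs_filter norm_nbhs_singleton norm_nbhs_nbhs.

Lemma norm_sub_continuous : continuous (fun x : G * G => x.1 - x.2).
Proof.
move=> [x y] /= A [e /= e0 eA].
exists ([set z | N (x - z) < e / 2], [set z | N (y - z) < e / 2]) => /=.
  by split; exists (e / 2) => //=; lra.
move=> [a b] /= [xa yb]; apply: eA => /=.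
by have := seminormB sN (x - a) (y - b); rewrite subrBB; lra.
Qed.

HB.instance Definition _ :=
  PreTopologicalNmodule_isTopologicalZmodule.Build G norm_sub_continuous.

Definition norm_topological_zmod : topologicalZmodType := G.

Definition norm_dist (x y : norm_topological_zmod) : R := N (x - y).

Lemma norm_dist_invariant_metric_group :
  metric_group norm_dist /\ Defs.invariant norm_dist.
Proof.
split; last by move=> x y z; rewrite /norm_dist opprD addrACA subrr addr0.
split=> //; split=> [x y|x y|x y|x y z].
- exact: (seminorm_ge0 sN).
- split=> [/nN.2/eqP|->]; last by rewrite /norm_dist subrr (seminorm0 sN).
  by rewrite subr_eq0 => /eqP.
- exact: (seminormC sN).
- exact: (seminorm_triangle sN).
Qed.

Lemma norm_separable (S : set norm_topological_zmod) : countable S ->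
  (forall x e, 0 < e -> exists2 y, S y & norm_dist x y < e) ->
  separable_space norm_topological_zmod.
Proof.
move=> cS dS; exists S => // O [x Ox] oO.
have [e /= e0 eO] : nbhs x O by apply: open_nbhs_nbhs.
by have [y Sy xy] := dS x e e0; exists y; split=> //; apply: eO.
Qed.

End NormTopology.

(** * Completion of a seminormed group *)

Section Completion.
Variables (R : realType) (A : zmodType) (M : A -> R) (sM : seminorm M).

Definition is_cauchy (u : nat -> A) := forall e, 0 < e ->
  exists n, forall i k, (n <= i)%N -> (n <= k)%N -> M (u i - u k) <= e.

Definition cauchy_pred : {pred (nat -> A)} := fun u => `[< is_cauchy u >].

Lemma cauchy_zmod_closed : zmod_closed cauchy_pred.
Proof.
split=> [|u v /asboolP cu /asboolP cv]; apply/asboolP => e e0.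
  by exists 0%N => i k _ _; rewrite subrr (seminorm0 sM) ltW.
have e20 : 0 < e / 2 by lra.
have [[n hn] [m hm]] := (cu _ e20, cv _ e20).
exists (maxn n m) => i k; rewrite !geq_max => /andP[ni mi] /andP[nk mk].
have := seminormB sM (u i - u k) (v i - v k).
rewrite subrBB.
move: (hn _ _ ni nk) (hm _ _ mi mk).
by rewrite -[(u - v) i]/(u i - v i) -[(u - v) k]/(u k - v k); lra.
Qed.

HB.instance Definition _ := GRing.isZmodClosed.Build _ cauchy_pred cauchy_zmod_closed.

Record cauchy_seq := CauchySeq { cseq : nat -> A; _ : cseq \in cauchy_pred }.
HB.instance Definition _ := [isSub for cseq].
HB.instance Definition _ := [Choice of cauchy_seq by <:].
HB.instance Definition _ := [SubChoice_isSubZmodule of cauchy_seq by <:].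

Lemma cseqB (u v : cauchy_seq) n : cseq (u - v) n = cseq u n - cseq v n.
Proof. by []. Qed.

Definition is_seq_limit (a : nat -> R) (l : R) := forall e, 0 < e ->
  exists n, forall i, (n <= i)%N -> `|a i - l| <= e.

Lemma seq_limit_exists (u : cauchy_seq) :
  exists l, is_seq_limit (M \o cseq u) l.
Proof.
have /asboolP cu := valP u.
have /cvg_ex[l hl] : cvgn (M \o cseq u).
  apply/cauchy_cvgP/cauchy_exP => e e0.
  have [n hn] := cu (e / 2) ltac:(lra).
  exists (M (cseq u n)); exists n => //= i /= ni.
  have := seminorm_dist sM (cseq u n) (cseq u i).
  by have := hn _ _ (leqnn n) ni; rewrite /ball /=; lra.
exists l => e e0; have /cvgrPdist_le /(_ e e0)[n _ hn] := hl.
by exists n => i ni; rewrite distrC; apply: hn.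
Qed.

Lemma seq_limit_unique a l l' : is_seq_limit a l -> is_seq_limit a l' -> l = l'.
Proof.
move=> h h'; apply/eqP; rewrite -subr_eq0 -normr_le0.
apply/ler_addgt0Pr => e e0; rewrite add0r.
have [n hn] := h (e / 2) ltac:(lra).
have [m hm] := h' (e / 2) ltac:(lra).
have := hn (maxn n m) (leq_maxl _ _); have := hm (maxn n m) (leq_maxr _ _).
by rewrite !ler_distl => /andP[? ?] /andP[? ?]; apply/andP; split; lra.
Qed.

Definition cauchy_norm (u : cauchy_seq) : R := projT1 (cid (seq_limit_exists u)).

Lemma cauchy_normP u : is_seq_limit (M \o cseq u) (cauchy_norm u).
Proof. exact: projT2 (cid (seq_limit_exists u)). Qed.

Lemma cauchy_norm_le (u : cauchy_seq) n r :
  (forall i, (n <= i)%N -> M (cseq u i) <= r) -> cauchy_norm u <= r.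
Proof.
move=> h; apply/ler_addgt0Pr => e e0.
have [m hm] := cauchy_normP u e0.
have := h (maxn n m) (leq_maxl _ _); have := hm (maxn n m) (leq_maxr _ _).
by rewrite /= ler_distl => /andP[? ?] ?; lra.
Qed.

Lemma cauchy_norm_seminorm : seminorm cauchy_norm.
Proof.
split.
  apply: (seq_limit_unique (cauchy_normP 0)) => e e0; exists 0%N => i _ /=.
  by rewrite (seminorm0 sM) subrr normr0 ltW.
move=> u v; apply/ler_addgt0Pr => e e0.
have [n hn] := cauchy_normP u (e := e / 2) ltac:(lra).
have [m hm] := cauchy_normP v (e := e / 2) ltac:(lra).
apply: (@cauchy_norm_le _ (maxn n m)) => i; rewrite geq_max => /andP[ni mi].
rewrite cseqB; have := seminormB sM (cseq u i) (cseq v i).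
have := hn _ ni; have := hm _ mi.
by rewrite /= !ler_distl => /andP[? ?] /andP[? ?]; lra.
Qed.

Let sC := cauchy_norm_seminorm.

Definition null_seq : {pred cauchy_seq} := fun u => cauchy_norm u == 0.

Lemma null_zmod_closed : zmod_closed null_seq.
Proof.
split=> [|u v]; first by rewrite -topredE /= /null_seq (seminorm0 sC).
rewrite -!topredE /= /null_seq => /eqP u0 /eqP v0.
have := seminormB sC u v; have := seminorm_ge0 sC (u - v).
by move=> ? ?; apply/eqP; lra.
Qed.

HB.instance Definition _ := GRing.isZmodClosed.Build _ null_seq null_zmod_closed.

(** The Hausdorff completion: dividing by the null sequences identifies points at distance 0, so the
    seminorm [M] turns into a norm. *)
Definition completion : zmodType := Quotient.quot null_seq.

Local Open Scope quotient_scope.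
Local Notation pi := (\pi_(Quotient.quot null_seq)).

Definition completion_norm (g : completion) : R :=
  cauchy_norm (repr (g : Quotient.quot null_seq)).

(** The chosen representative differs from [u] by a null sequence, and [cauchy_norm] is 1-Lipschitz
    for itself. *)
Lemma completion_normE u : completion_norm (pi u : completion) = cauchy_norm u.
Proof.
have : repr (pi u) - u \in null_seq by rewrite Quotient.idealrBE reprK.
rewrite -topredE /= /null_seq => /eqP h.
apply/eqP; rewrite -subr_eq0 -normr_le0 -h.
exact: (seminorm_dist sC).
Qed.

Lemma piB u v : pi (u - v) = pi u - pi v :> completion.
Proof. exact: raddfB. Qed.

Lemma completion_is_norm : is_norm completion_norm.
Proof.
split; first split.
- by rewrite -(subrr (pi 0 : completion)) -piB subrr completion_normE (seminorm0 sC).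
- move=> x y; rewrite -[x](@reprK _ (Quotient.quot null_seq)).
  rewrite -[y](@reprK _ (Quotient.quot null_seq)) -piB !completion_normE.
  exact: (seminormB sC).
- move=> x; rewrite -[x](@reprK _ (Quotient.quot null_seq)) completion_normE.
  move=> h; rewrite -(subrr (pi 0 : completion)) -piB subrr.
  apply/eqP; rewrite -Quotient.idealrBE subr0.
  by rewrite -topredE /= /null_seq h.
Qed.

Lemma const_cauchy (a : A) : (fun=> a) \in cauchy_pred.
Proof.
by apply/asboolP => e e0; exists 0%N => i k _ _; rewrite subrr (seminorm0 sM) ltW.
Qed.

Definition const_cseq (a : A) := CauchySeq (const_cauchy a).

Definition completion_space := norm_topological_zmod completion_is_norm.
Definition completion_dist : completion_space -> completion_space -> R :=
  @norm_dist _ _ _ completion_is_norm.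

Definition to_completion (a : A) : completion_space := pi (const_cseq a).

Lemma to_completion_is_zmod_morphism : zmod_morphism to_completion.
Proof.
move=> a b; rewrite /to_completion -[RHS](piB (const_cseq a) (const_cseq b)).
by congr (pi _); apply: val_inj; apply/funext.
Qed.

HB.instance Definition _ := GRing.isZmodMorphism.Build A completion_space
  to_completion to_completion_is_zmod_morphism.

Lemma to_completion_dist (a : A) (u : cauchy_seq) r n :
  (forall i, (n <= i)%N -> M (a - cseq u i) <= r) ->
  completion_dist (to_completion a) (pi u) <= r.
Proof.
move=> h; rewrite /completion_dist /norm_dist.
have -> : completion_norm (to_completion a - pi u) = cauchy_norm (const_cseq a - u).
  by rewrite -completion_normE piB.
exact: (@cauchy_norm_le (const_cseq a - u) n r h).
Qed.

Lemma to_completion_norm a : completion_dist (to_completion a) 0 = M a.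
Proof.
rewrite /completion_dist /norm_dist subr0 completion_normE.
apply: (seq_limit_unique (cauchy_normP _)) => e e0; exists 0%N => i _ /=.
by rewrite subrr normr0 ltW.
Qed.

(** The form of completeness that the isometric extension uses; the limit is the class of the
    sequence itself. *)
Lemma to_completion_limit (u : nat -> A) : is_cauchy u ->
  exists g, forall e, 0 < e ->
    exists n, forall i, (n <= i)%N -> completion_dist (to_completion (u i)) g <= e.
Proof.
move=> cu; have cu' : u \in cauchy_pred by apply/asboolP.
exists (pi (CauchySeq cu')) => e /cu[n hn]; exists n => i ni.
by apply: (@to_completion_dist _ _ _ n) => k nk; apply: hn.
Qed.

Lemma to_completion_dense (g : completion_space) e : 0 < e ->
  exists a, completion_dist (to_completion a) g <= e.
Proof.
move=> e0; rewrite -[g](@reprK _ (Quotient.quot null_seq)).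
have /asboolP /(_ e e0)[n hn] := valP (repr (g : Quotient.quot null_seq)).
exists (cseq (repr (g : Quotient.quot null_seq)) n).
by apply: (@to_completion_dist _ _ _ n) => i; apply: hn.
Qed.

End Completion.

Lemma completion_separable (R : realType) (A : countZmodType) (M : A -> R)
  (sM : seminorm M) : separable_invariant_metric_group (@completion_dist _ _ _ sM).
Proof.
have [mG iG] := norm_dist_invariant_metric_group (completion_is_norm sM).
split=> //.
apply: (@norm_separable _ _ _ _ (range (to_completion sM))).
  exact: card_le_trans (card_image_le _ _) (countableP _).
move=> g e e0; have [a ha] := to_completion_dense g (e := e / 2) ltac:(lra).
exists (to_completion sM a); first by exists a.
by case: mG => -[_ _ -> _] _; rewrite (le_lt_trans ha) //; lra.
Qed.

(** * Finite nets and weighted l1 norms on Z[X] *)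

Lemma finite_net (R : realType) (T : eqType) (Q : T -> Prop) (n : nat)
    (f : 'I_n -> T -> R) (C eta : R) : 0 < eta ->
  (forall j x, Q x -> `|f j x| <= C) ->
  exists s : seq T, (forall y, y \in s -> Q y) /\
    (forall x, Q x -> exists2 y, y \in s & forall j, `|f j x - f j y| <= eta).
Proof.
(* Each [f j x], shifted by [C] into [0, 2C], is rounded down to a multiple of [eta]. Only [K.+1]
   levels occur, and points with the same levels for all [j] are [eta]-close, so one point per
   vector of levels is enough. *)
move=> eta0 fC; pose K := Num.truncn (2 * C / eta).
pose level x j := Num.truncn ((f j x + C) / eta).
have lev x j : Q x -> (level x j)%:R * eta <= f j x + C < (level x j).+1%:R * eta.
  move=> /(fC j); rewrite ler_norml => /andP[h1 h2].
  have /truncn_itv : 0 <= (f j x + C) / eta by apply: divr_ge0; lra.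
  by rewrite -/(level x j) ler_pdivlMr // ltr_pdivrMr.
have levK x j : Q x -> (level x j < K.+1)%N.
  move=> /(fC j); rewrite ler_norml => /andP[h1 h2].
  rewrite ltnS; apply: le_truncn; rewrite ler_pM2r ?invr_gt0 //; lra.
pose color x : {ffun 'I_n -> 'I_K.+1} := [ffun j => inord (level x j)].
(* A colour that no point of [Q] has contributes the empty list. *)
pose pick c : seq T :=
  if pselect (exists x, Q x /\ color x = c) is left h then [:: projT1 (cid h)] else [::].
exists (flatten [seq pick c | c <- enum {ffun 'I_n -> 'I_K.+1}]); split.
  move=> y /flatten_mapP[c _]; rewrite /pick; case: pselect => // h.
  by rewrite inE => /eqP ->; case: (cid h) => z [].
move=> x Qx; have h : exists y, Q y /\ color y = color x by exists x.
exists (projT1 (cid h)).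
  apply/flatten_mapP; exists (color x); first by rewrite mem_enum.
  rewrite /pick; case: pselect => [h'|//].
  by rewrite (Prop_irrelevance h h') mem_seq1.
case: (cid h) => y [Qy cxy] /= j.
have /(congr1 (fun c : {ffun _ -> _} => nat_of_ord (c j))) := cxy; rewrite !ffunE.
rewrite !inordK ?levK // => e.
have := lev _ j Qx; have := lev _ j Qy; rewrite e.
rewrite -natr1 mulrDl mul1r => /andP[? ?] /andP[? ?].
by rewrite ler_norml; apply/andP; split; lra.
Qed.

Section WeightedNorm.
Variables (R : realType) (w : nat -> R).
Hypothesis w0 : forall i, 0 <= w i.
Implicit Types x y : {poly int}.

Definition wnorm x : R := \sum_(i < size x) `|x`_i|%:~R * w i.

Lemma wnormE n x : (size x <= n)%N -> wnorm x = \sum_(i < n) `|x`_i|%:~R * w i.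
Proof.
move=> xn; rewrite /wnorm (big_ord_widen n (fun i => `|x`_i|%:~R * w i) xn).
rewrite [RHS](bigID (fun i : 'I_n => (i < size x)%N)) /= [X in _ = _ + X]big1 ?addr0 //.
by move=> i; rewrite -leqNgt => /(nth_default 0) ->; rewrite normr0 mul0r.
Qed.

Lemma wnorm_seminorm : seminorm wnorm.
Proof.
split=> [|x y]; first by rewrite /wnorm size_poly0 big_ord0.
have n1 : (size (x - y)%R <= maxn (size x) (size y))%N.
  by rewrite (leq_trans (size_polyD _ _)) // size_polyN.
rewrite (wnormE n1) (wnormE (leq_maxl (size x) (size y))).
rewrite (wnormE (leq_maxr (size x) (size y))) -big_split /=; apply: ler_sum => i _.
by rewrite -mulrDl ler_wpM2r // -intrD ler_int coefB ler_normB.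
Qed.

Lemma coef_le_wnorm x i : `|x`_i|%:~R * w i <= wnorm x.
Proof.
have [xi|ix] := leqP (size x) i.
  by rewrite nth_default // normr0 mul0r (seminorm_ge0 wnorm_seminorm).
rewrite /wnorm (bigD1 (Ordinal ix)) //= lerDl sumr_ge0 // => j _.
by rewrite mulr_ge0 // ler0z.
Qed.

(** Triangle inequality over the monomials of [x]: [wnorm] is the largest seminorm with values at
    most [w i] at ['X^i]. *)
Lemma seminorm_le_wnorm (N : {poly int} -> R) : seminorm N ->
  (forall i, N 'X^i <= w i) -> forall x, N x <= wnorm x.
Proof.
move=> sN Nw x; rewrite -{1}[x]coefK poly_def.
apply: le_trans (seminorm_sum sN _ _ _) _; apply: ler_sum => i _.
rewrite -[x`_i in X in X <= _]intz scaler_int mulrC.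
apply: le_trans (seminormMz sN _ _) _.
by rewrite ler_wpM2r // ler0z.
Qed.
End WeightedNorm.

(** * Separability of the seminorms bounded by the linear weight *)

Section Approximation.
Variable R : realType.
Implicit Types (x y : {poly int}) (N P : {poly int} -> R).

Definition lin_weight (i : nat) : R := i.+1%:R.
(** The ratio to [lin_weight] is i + 1, which is unbounded: the part of [lin_norm x] from index m on
    is at most [sqr_norm x] / m. This is what makes tails negligible. *)
Definition sqr_weight (i : nat) : R := i.+1%:R ^+ 2.
Definition lin_norm := wnorm lin_weight.
Definition sqr_norm := wnorm sqr_weight.

Lemma lin_weight_ge0 i : 0 <= lin_weight i. Proof. exact: ler0n. Qed.
Lemma sqr_weight_ge0 i : 0 <= sqr_weight i. Proof. exact: sqr_ge0. Qed.

Let sB : seminorm lin_norm := wnorm_seminorm lin_weight_ge0.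
Let sW : seminorm sqr_norm := wnorm_seminorm sqr_weight_ge0.

Lemma lin_norm_le_sqr_norm x : lin_norm x <= sqr_norm x.
Proof.
apply: ler_sum => i _; rewrite ler_wpM2l ?ler0z //.
by rewrite /sqr_weight expr2 ler_peMr ?ler0n // ler1n.
Qed.

Lemma coef_le_sqr_norm x i : `|x`_i|%:~R <= sqr_norm x.
Proof.
apply: le_trans (coef_le_wnorm sqr_weight_ge0 x i).
by rewrite ler_peMr ?ler0z // /sqr_weight exprn_ege1 // ler1n.
Qed.

Lemma sqr_norm_ge1 x : x != 0 -> 1 <= sqr_norm x.
Proof.
move=> x0; apply: le_trans (coef_le_sqr_norm x (size x).-1).
by rewrite (ler_int _ 1) -/(lead_coef x) -gtz0_ge1 normr_gt0 lead_coef_eq0.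
Qed.

Lemma sqr_ball_finite (C : R) : exists s : seq {poly int},
  forall x, sqr_norm x <= C -> x \in s.
Proof.
pose m := Num.truncn C.
have half0 : 0 < 2^-1 :> R by lra.
(* Integer coefficients that differ by at most 1/2 are equal, so a net for the coefficients up to
   [m] lists the whole ball. *)
have [|s [sQ sP]] := @finite_net R {poly int} (fun x => sqr_norm x <= C) m.+1
    (fun j x => (x`_j)%:~R) C 2^-1 half0.
  move=> j x xC; apply: le_trans xC; apply: le_trans (coef_le_sqr_norm x j).
  by rewrite intr_norm.
exists s => x xC; have [y ys xy] := sP _ xC.
(* A nonzero coefficient at [i > m] alone costs at least i + 1 > C. *)
have small z i : sqr_norm z <= C -> (m < i)%N -> z`_i = 0.
  move=> zC mi; apply/eqP/contraT; rewrite -normr_gt0 gtz0_ge1 => z1.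
  have := coef_le_wnorm sqr_weight_ge0 z i; rewrite -/(sqr_norm z) => h.
  have : (i.+1%:R : R) <= C.
    apply: le_trans zC; apply: le_trans h.
    rewrite -[leLHS]mul1r ler_pM ?ler0n ?ler1z // /sqr_weight expr2.
    by rewrite ler_peMr ?ler0n // ler1n.
  have C0 : 0 <= C by apply: le_trans zC; exact: seminorm_ge0.
  have := truncn_itv C0; rewrite -/m => /andP[_ Cm] iC.
  by have := le_lt_trans iC Cm; rewrite ltr_nat ltnS => /ltn_trans/(_ mi); rewrite ltnn.
suff -> : x = y by [].
apply/polyP => i; have [mi|im] := ltnP m i; first by rewrite !small // sQ.
have := xy (Ordinal (im : (i < m.+1)%N)); rewrite /= -intrB -intr_norm => h.
have : (`|x`_i - y`_i|%:~R : R) < 1%:~R by rewrite (le_lt_trans h) //; lra.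
by rewrite ltr_int => h1; apply/eqP; rewrite -subr_eq0 -normr_le0 leNgt gtz0_ge1 -ltNge.
Qed.

(* Pigeonhole: up to a small error, x is an integer multiple of one of finitely
   many vectors y, along which N x / W x and N y / W y are close. *)
Lemma finitely_determined N (eps : R) : seminorm N ->
  (forall x, N x <= lin_norm x) -> 0 < eps ->
  exists l : seq {poly int}, exists2 delta : R, 0 < delta &
    forall P, seminorm P -> (forall x, P x <= lin_norm x) ->
      (forall g, g \in l -> P g <= N g + delta) ->
      forall x, P x <= N x + eps * sqr_norm x.
Proof.
move=> sN NB e0.
(* [m] is a cut-off for the remainder [r] below: its first [m] coordinates will contribute about m^2
   * eta * W x to [lin_norm r], and the others at most 2 * W x / m. *)
have [m m0 me] : exists2 m : nat, (0 < m)%N & 2 / (m%:R : R) <= eps / 4.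
  exists (Num.truncn (8 / eps)).+1 => //.
  have /truncn_itv/andP[_] : 0 <= 8 / eps by apply: divr_ge0; lra.
  rewrite ltr_pdivrMr // ler_pdivrMr ?ltr0n // => h; lra.
have m1 : (1 : R) <= m%:R by rewrite ler1n.
have m2 : (1 : R) <= m%:R ^+ 2 by rewrite exprn_ege1.
have [eta eta0 etam] : exists2 eta : R, 0 < eta & m%:R ^+ 2 * eta = eps / 8.
  exists (eps / (8 * m%:R ^+ 2)); first by rewrite divr_gt0 //; lra.
  by field; rewrite pnatr_eq0 -lt0n.
have W0 x : x != 0 -> 0 < sqr_norm x by move=> /sqr_norm_ge1; lra.
have NW x : N x <= sqr_norm x := le_trans (NB x) (lin_norm_le_sqr_norm x).
(* A net for directions: the functions with [j < m] are normalised coordinates, and the last index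
   [j = m] carries the ratio of [N] to [sqr_norm]. *)
have [|s [sQ sP]] := @finite_net R {poly int} (fun x => x != 0) m.+1
  (fun j x => if (j < m)%N then (x`_j)%:~R / sqr_norm x else N x / sqr_norm x)
  1 eta eta0.
  move=> j x x0; have Wx := W0 _ x0.
  case: ifP => _; rewrite normrM normfV (ger0_norm (ltW Wx)) ler_pdivrMr // mul1r.
    by rewrite -intr_norm coef_le_sqr_norm.
  by rewrite ger0_norm ?(seminorm_ge0 sN).
pose C := \sum_(y <- s) lin_norm y.
have BC y : y \in s -> lin_norm y <= C.
  move=> ys; rewrite /C (big_rem y ys) /= lerDl sumr_ge0 // => z _.
  exact: (seminorm_ge0 sB).
(* The finitely many short [x] are put on the list themselves; for the others, [C] is at most eps/4
   * W x. *)
have [t tP] := sqr_ball_finite (4 * C / eps).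
exists (s ++ t); exists (eps / 4); first lra.
move=> P sP' PB Pl x.
have [->|x0] := eqVneq x 0.
  by rewrite (seminorm0 sP') (seminorm0 sN) (seminorm0 sW) mulr0 addr0.
have Wx1 := sqr_norm_ge1 x0; have Wx := W0 _ x0.
have eWx : eps <= eps * sqr_norm x by rewrite ler_peMr // ltW.
have [xt|xt] := boolP (x \in t).
  have := Pl x; rewrite mem_cat xt orbT => /(_ isT); lra.
have CW : C <= eps / 4 * sqr_norm x.
  have : ~~ (sqr_norm x <= 4 * C / eps) by apply: contra xt; apply: tP.
  by rewrite -ltNge ltr_pdivrMr // => ?; lra.
have [y ys xy] := sP _ x0.
have y0 := sQ _ ys; have Wy := W0 _ y0; have Wy1 := sqr_norm_ge1 y0.
(* [q] is the integer part of W x / W y, so that [y *+ q] has nearly the direction and the size of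
   [x]. *)
have [q [qW qW']] : exists q : nat,
    q%:R * sqr_norm y <= sqr_norm x /\ sqr_norm x < (q%:R + 1) * sqr_norm y.
  have /truncn_itv/andP[] : 0 <= sqr_norm x / sqr_norm y by rewrite divr_ge0 // ltW.
  rewrite ler_pdivlMr // ltr_pdivrMr // => h1 h2.
  by exists (Num.truncn (sqr_norm x / sqr_norm y)); rewrite natr1.
have q0 : 0 <= q%:R :> R by exact: ler0n.
have NqN : q%:R * N y <= N x + eta * sqr_norm x.
  have := xy ord_max; rewrite ltnn ler_norml => /andP[h _].
  have {}h : N y / sqr_norm y <= N x / sqr_norm x + eta by lra.
  have /(le_trans _) : N y / sqr_norm y * sqr_norm x <= N x + eta * sqr_norm x.
    rewrite (le_trans (ler_wpM2r (ltW Wx) h)) // mulrDl divfK //.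
    by rewrite gt_eqF.
  apply; have -> : q%:R * N y = N y / sqr_norm y * (q%:R * sqr_norm y).
    by field; rewrite gt_eqF.
  by rewrite ler_wpM2l // divr_ge0 ?(seminorm_ge0 sN) ?ltW.
have qdelta : q%:R <= sqr_norm x.
  by apply: le_trans qW; rewrite ler_peMr.
pose r := x - y *+ q.
have Br : lin_norm r <= (m%:R ^+ 2 * eta + 2 / m%:R) * sqr_norm x + lin_norm y.
  pose n := maxn m (maxn (size x) (size y)).
  have [mn xn yn] : [/\ (m <= n)%N, (size x <= n)%N & (size y <= n)%N].
    by rewrite /n !leq_max !leqnn !orbT.
  have rn : (size r <= n)%N.
    rewrite (leq_trans (size_polyD _ _)) // geq_max xn size_polyN.
    by apply: leq_trans yn; rewrite -scaler_nat size_scale_leq.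
  have term (i : 'I_n) : `|r`_i|%:~R * lin_weight i <=
      (if (i < m)%N then m%:R * (eta * sqr_norm x) else 0) +
      `|y`_i|%:~R * lin_weight i +
      (`|x`_i|%:~R * sqr_weight i + q%:R * (`|y`_i|%:~R * sqr_weight i)) / m%:R.
    rewrite coefB coefMn !intr_norm rmorphB rmorphMn /=.
    have wi0 : 0 < lin_weight i by rewrite ltr0n.
    have nx0 := normr_ge0 ((x`_i)%:~R : R); have ny0 := normr_ge0 ((y`_i)%:~R : R).
    case: ifP => im.
      have := xy (Ordinal (leqW im)); rewrite /= im => xyi.
      have rest0 : 0 <= (`|(x`_i)%:~R| * sqr_weight i +
          q%:R * (`|(y`_i)%:~R| * sqr_weight i)) / m%:R.
        by rewrite divr_ge0 ?addr_ge0 ?mulr_ge0 ?sqr_weight_ge0 ?normr_ge0.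
      have wm : lin_weight i <= m%:R by rewrite ler_nat.
      have ri : `|(x`_i)%:~R - (y`_i)%:~R *+ q| <= eta * sqr_norm x + `|(y`_i)%:~R|.
        rewrite (_ : _ - _ = ((x`_i)%:~R / sqr_norm x - (y`_i)%:~R / sqr_norm y) * sqr_norm x
          + (y`_i)%:~R / sqr_norm y * (sqr_norm x - q%:R * sqr_norm y)); last first.
          by rewrite -mulr_natl; field; rewrite !gt_eqF.
        rewrite (le_trans (ler_normD _ _)) // lerD // normrM.
          by rewrite (ger0_norm (ltW Wx)) ler_wpM2r // ltW.
        rewrite (@ger0_norm _ (_ - _)) ?subr_ge0 // normrM normfV (ger0_norm (ltW Wy)).
        rewrite -mulrA ler_piMr // mulrC ler_pdivrMr // mul1r; lra.
      have : `|(x`_i)%:~R - (y`_i)%:~R *+ q| * lin_weight i <=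
          (eta * sqr_norm x + `|(y`_i)%:~R|) * lin_weight i.
        by rewrite ler_wpM2r // ltW.
      have : eta * sqr_norm x * lin_weight i <= eta * sqr_norm x * m%:R.
        by rewrite ler_wpM2l // mulr_ge0 // ltW.
      by rewrite mulrDl; lra.
    rewrite add0r.
    have mi : m%:R <= lin_weight i by rewrite ler_nat ltnW // ltnS leqNgt im.
    have ri : `|(x`_i)%:~R - (y`_i)%:~R *+ q| <= `|(x`_i)%:~R| + q%:R * `|(y`_i)%:~R| :> R.
      by rewrite (le_trans (ler_normB _ _)) // normrMn mulr_natl.
    rewrite (le_trans (ler_wpM2r (ltW wi0) ri)) // ler_wpDl ?mulr_ge0 ?(ltW wi0) //.
    rewrite ler_pdivlMr ?ltr0n // mulrA -mulrDl -mulrA.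
    by rewrite ler_wpM2l ?addr_ge0 ?mulr_ge0 // /sqr_weight expr2 ler_wpM2l // ltW.
  rewrite /lin_norm (wnormE _ rn) (le_trans (ler_sum _ (fun i _ => term i))) //.
  rewrite big_split big_split /= -mulr_suml big_split /= -mulr_sumr.
  rewrite -!wnormE // -/(sqr_norm x) -/(sqr_norm y) -/(lin_norm y).
  rewrite -(big_mkcond (fun i : 'I_n => (i < m)%N)) /=.
  rewrite -(big_ord_widen n (fun=> m%:R * (eta * sqr_norm x)) mn).
  rewrite sumr_const card_ord -[_ *+ m]mulr_natl mulrDl.
  have : (sqr_norm x + q%:R * sqr_norm y) / m%:R <= 2 * sqr_norm x / m%:R.
    by rewrite ler_wpM2r ?invr_ge0 //; lra.
  rewrite expr2; lra.
have Py := Pl y; rewrite mem_cat ys in Py; have {}Py := Py isT.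
(* The errors, in units of eps * W x, add up to 1: 1/4 from [delta], 1/8 + 1/4 + 1/4 from
   [lin_norm r] (the last for [lin_norm y <= C]), and 1/8 from replacing q * N y by N x. *)
have : P x <= P y *+ q + lin_norm r.
  rewrite -[X in P X <= _](subrKC (y *+ q) x).
  rewrite (le_trans (seminormD sP' _ _)) // lerD // ?PB //.
  exact: (seminormMn sP').
have := BC _ ys.
have : q%:R * P y <= q%:R * (N y + eps / 4) by rewrite ler_wpM2l.
have : eps * q%:R <= eps * sqr_norm x by rewrite ler_wpM2l // ltW.
have : 2 / m%:R * sqr_norm x <= eps / 4 * sqr_norm x by rewrite ler_wpM2r // ltW.
have : eta * sqr_norm x <= eps / 8 * sqr_norm x.
  by rewrite ler_wpM2r ?(ltW Wx) // -etam ler_peMl // ltW.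
move: Br NqN CW; rewrite etam -[P y *+ q]mulr_natl mulrDr mulrDl.
move: (sqr_norm x) => w *; lra.
Qed.
Definition bounded_seminorm N := seminorm N /\ forall x, N x <= lin_norm x.

Lemma bounded_seminorm_dist N N' x : bounded_seminorm N -> bounded_seminorm N' ->
  `|N x - N' x| <= sqr_norm x.
Proof.
move=> [sN NB] [sN' NB']; have := lin_norm_le_sqr_norm x.
have := NB x; have := NB' x; have := seminorm_ge0 sN x; have := seminorm_ge0 sN' x.
by move=> *; rewrite ler_norml; apply/andP; split; lra.
Qed.

Let bounded_by (l : seq ({poly int} * rat)) P :=
  forall gq, gq \in l -> P gq.1 <= ratr gq.2.

(** Up to e * W, [N] is the largest bounded seminorm obeying the finitely many rational bounds in
    [l]. Two seminorms determined by the same pair [(e, l)] thus differ by at most e * W, and there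
    are only countably many pairs. *)
Let determined_by (e : rat) l N := [/\ bounded_seminorm N, bounded_by l N &
  forall P, bounded_seminorm P -> bounded_by l P ->
    forall x, P x <= N x + ratr e * sqr_norm x].

Lemma bounded_seminorms_separable : exists D : nat -> {poly int} -> R,
  (forall n, bounded_seminorm (D n)) /\
  forall N (e : R), bounded_seminorm N -> 0 < e ->
    exists n, forall x, `|D n x - N x| <= e * sqr_norm x.
Proof.
(* One seminorm is chosen for each pair; pairs that determine none get the zero seminorm. *)
pose D (el : rat * seq ({poly int} * rat)) :=
  if pselect (exists N, determined_by el.1 el.2 N) is left h then projT1 (cid h)
  else fun=> 0.
exists (fun n => D (odflt (0, [::]) (unpickle n))); split=> [n|N e bN e0].
  rewrite /D; case: pselect => [h|_]; first by case: (cid h) => N [].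
  split; last by move=> x; have := seminorm_ge0 sB x.
  by split=> // x y; rewrite addr0.
have [e' /andP[e'0 e'e]] := rat_in_itvoo e0.
have [l [delta delta0 lP]] := finitely_determined bN.1 bN.2 e'0.
(* A rational bound that [N] meets and that forces any other [P] below [N g + delta]. *)
have qP g : exists q : rat, N g < ratr q < N g + delta.
  have /rat_in_itvoo[q] : N g < N g + delta by lra.
  by exists q.
pose l' := [seq (g, projT1 (cid (qP g))) | g <- l].
have dN : determined_by e' l' N.
  split=> //.
    by move=> _ /mapP[g _ ->] /=; case: (cid (qP g)) => q /= /andP[/ltW].
  move=> P [sP PB] Pl x; apply: lP => // g gl.
  have /Pl /= : (g, projT1 (cid (qP g))) \in l' by apply/mapP; exists g.
  by case: (cid (qP g)) => q /= /andP[_ /ltW qd] /le_trans; apply.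
exists (pickle (e', l')) => x; rewrite pickleK /= /D.
case: pselect => [h|[]]; last by exists N.
case: (cid h) => N' /= [bN' N'l N'P]; case: dN => _ Nl NP.
have := N'P _ bN Nl x; have := NP _ bN' N'l x => h1 h2.
have : ratr e' * sqr_norm x <= e * sqr_norm x.
  by rewrite ler_wpM2r ?(seminorm_ge0 sW) // ltW.
by move=> ?; rewrite ler_norml; apply/andP; split; lra.
Qed.

End Approximation.

(** * Gluing one new copy of F along an edge *)

Section InfConvolution.
Variables (R : realType) (V F : zmodType).
Variables (i : {additive F -> V}) (c : {additive V -> F}).
Variables (M : V -> R) (K N' : F -> R).
Hypotheses (sM : seminorm M) (sK : seminorm K) (sN' : seminorm N').

(** [c u] is the coordinate in the new copy, which [M] ignores in the application. A portion [z] of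
    it is carried along the edge at cost [K z] and charged to [M] as [i z]; the rest is charged to
    [N']. *)
Let cost u z := M (u + i z) + K z + N' (c u - z).

Definition inf_convolution (u : V) : R := inf (range (cost u)).

Let cost_ge0 u z : 0 <= cost u z.
Proof.
by rewrite !addr_ge0 ?(seminorm_ge0 sM) ?(seminorm_ge0 sK) ?(seminorm_ge0 sN').
Qed.

Lemma inf_convolution_le u z : inf_convolution u <= M (u + i z) + K z + N' (c u - z).
Proof.
apply: ge_inf; last by exists z.
by exists 0 => _ [z' _ <-]; apply: cost_ge0.
Qed.

Lemma le_inf_convolution u r :
  (forall z, r <= M (u + i z) + K z + N' (c u - z)) -> r <= inf_convolution u.
Proof.
move=> h; apply: lb_le_inf; first by exists (cost u 0); exists 0.
by move=> _ [z _ <-]; apply: h.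
Qed.

Lemma inf_convolution_seminorm : seminorm inf_convolution.
Proof.
split.
  apply/le_anti/andP; split; last by apply: le_inf_convolution => z; exact: cost_ge0.
  have := inf_convolution_le 0 0.
  rewrite (raddf0 i) (raddf0 c) addr0 subr0.
  by rewrite (seminorm0 sM) (seminorm0 sK) (seminorm0 sN') !addr0.
move=> u v; rewrite -lerBlDr; apply: le_inf_convolution => z.
rewrite lerBlDr -lerBlDl; apply: le_inf_convolution => z'; rewrite lerBlDl.
apply: le_trans (inf_convolution_le (u - v) (z - z')) _.
rewrite (raddfB i) (raddfB c) addrACA -opprD.
rewrite subrBB.
have := seminormB sM (u + i z) (v + i z'); have := seminormB sK z z'.
have := seminormB sN' (c u - z) (c v - z'); lra.
Qed.

Variable N : F -> R.
Hypothesis MN : forall z, M (i z) <= N z.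

(** A detour of [z] through the new copy costs [N' z + K z], at least the [N z] that it could save
    in [M]. *)
Lemma inf_convolution_old u : c u = 0 -> (forall z, N z <= N' z + K z) ->
  inf_convolution u = M u.
Proof.
move=> cu NN'; apply/le_anti/andP; split.
  have := inf_convolution_le u 0.
  by rewrite cu (raddf0 i) subrr addr0 (seminorm0 sK) (seminorm0 sN') !addr0.
apply: le_inf_convolution => z; rewrite cu sub0r (seminormN sN').
have := NN' z; have := MN z; have := seminormB sM (u + i z) (i z).
by rewrite addrK; lra.
Qed.

(** Dually, sending [z] through the old part costs [N z + K z], which is no cheaper than [N' z]. *)
Lemma inf_convolution_new v : M v = 0 -> (forall z, M (v + i z) = N z) ->
  (forall z, N' z <= N z + K z) -> inf_convolution v = N' (c v).
Proof.
move=> Mv MvN NN'; apply/le_anti/andP; split.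
  have := inf_convolution_le v 0.
  by rewrite (raddf0 i) addr0 subr0 Mv (seminorm0 sK) !add0r.
apply: le_inf_convolution => z; rewrite MvN.
have := NN' z; have := seminormD sN' (c v - z) z; rewrite subrK; lra.
Qed.

End InfConvolution.

(** * Amalgamation along a countable tree *)

Section TreeAmalgam.
Variables (R : realType) (F : nzRingType).

(** The inclusion of the k-th copy of [F]; [{poly F}] serves as the direct sum of countably many
    copies. *)
Definition monomial k (x : F) : {poly F} := x%:P * 'X^k.

Lemma monomial_is_zmod_morphism k : zmod_morphism (monomial k).
Proof. by move=> x y; rewrite /monomial polyCB mulrBl. Qed.
HB.instance Definition _ k := GRing.isZmodMorphism.Build F {poly F} (monomial k)
  (monomial_is_zmod_morphism k).

Lemma coef_monomial k x j : (monomial k x)`_j = if j == k then x else 0.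
Proof.
by rewrite coefCM coefXn; case: eqP => _; rewrite ?mulr1 ?mulr0.
Qed.

Lemma size_monomial k x n : (k < n)%N -> (size (monomial k x) <= n)%N.
Proof.
move=> kn; apply/leq_sizeP => j nj; rewrite coef_monomial; case: eqP => // jk.
by move: nj; rewrite jk leqNgt kn.
Qed.

Variables (N K : nat -> F -> R) (parent : nat -> nat).
Hypotheses (sN : forall n, seminorm (N n)) (sK : forall n, seminorm (K n)).
Hypothesis parent_le : forall n, (parent n <= n)%N.
Hypothesis NK : forall n x, `|N n.+1 x - N (parent n) x| <= K n x.

(** Nodes are glued one at a time. The edge with index [m] joins node [m.+1] to [parent m], and
    stage [n] sees only the coordinates 0 to [n]. *)
Fixpoint amalgam n : {poly F} -> R :=
  if n is m.+1
  then inf_convolution (monomial (parent m)) (coefp m.+1) (amalgam m) (K m) (N m.+1)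
  else fun u => N 0 u`_0.

Lemma amalgam_seminorm n : seminorm (amalgam n).
Proof.
elim: n => [|n IH] /=; last exact: inf_convolution_seminorm.
by split=> [|u v]; rewrite ?coef0 ?coefB ?(seminorm0 (sN 0)) ?(seminormB (sN 0)).
Qed.

Lemma eq_amalgam n (u v : {poly F}) : (forall j, (j <= n)%N -> u`_j = v`_j) ->
  amalgam n u = amalgam n v.
Proof.
elim: n u v => [|n IH] u v uv /=; first by rewrite uv.
rewrite /inf_convolution; congr (inf _); apply: eq_imagel => z _.
have -> : amalgam n (u + monomial (parent n) z) = amalgam n (v + monomial (parent n) z).
  by apply: IH => j jn; rewrite !coefD uv // leqW.
by rewrite /= /coefp uv.
Qed.

Let NK1 n x : N (parent n) x <= N n.+1 x + K n x.
Proof. by have := NK n x; rewrite ler_norml => /andP[]; lra. Qed.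
Let NK2 n x : N n.+1 x <= N (parent n) x + K n x.
Proof. by have := NK n x; rewrite ler_norml => /andP[]; lra. Qed.

Lemma amalgam_monomial n k x : (k <= n)%N -> amalgam n (monomial k x) = N k x.
Proof.
elim: n k x => [|n IH] k x; first by rewrite leqn0 => /eqP -> /=; rewrite coef_monomial.
have IHp z : amalgam n (monomial (parent n) z) = N (parent n) z by rewrite IH.
have IHp' z : amalgam n (monomial (parent n) z) <= N (parent n) z by rewrite IHp.
rewrite leq_eqVlt => /predU1P[->|kn]; last first.
  rewrite -(IH k x) //.
  apply: (inf_convolution_old (amalgam_seminorm n) (sK n) (sN n.+1) IHp') => //.
  by rewrite /= /coefp coef_monomial gtn_eqF.
have new_ext u : amalgam n (monomial n.+1 x + u) = amalgam n u.
  by apply: eq_amalgam => j jn; rewrite coefD coef_monomial ltn_eqF // add0r.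
have -> : amalgam n.+1 (monomial n.+1 x) = N n.+1 (coefp n.+1 (monomial n.+1 x)).
  apply: (inf_convolution_new _ (amalgam_seminorm n) (sK n) (sN n.+1) _ _ (NK2 n)).
    by rewrite -[monomial _ _]addr0 new_ext (seminorm0 (amalgam_seminorm n)).
  by move=> z; rewrite new_ext IHp.
by rewrite /coefp coef_monomial eqxx.
Qed.

Lemma amalgam_stable n (u : {poly F}) :
  (size u <= n.+1)%N -> amalgam n.+1 u = amalgam n u.
Proof.
move=> un; have MN z : amalgam n (monomial (parent n) z) <= N (parent n) z.
  by rewrite amalgam_monomial.
apply: (inf_convolution_old (amalgam_seminorm n) (sK n) (sN n.+1) MN) => //.
by rewrite /= /coefp nth_default.
Qed.

(** The limit of the stages: [amalgam n u] is constant from [n = size u] on, since gluing a new leaf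
    preserves the old part. *)
Definition tree_amalgam (u : {poly F}) := amalgam (size u) u.

Lemma tree_amalgamE n (u : {poly F}) : (size u <= n)%N -> tree_amalgam u = amalgam n u.
Proof.
move=> /subnKC <-; elim: (n - _)%N => [|k IH]; first by rewrite addn0.
by rewrite IH addnS amalgam_stable // ltnW // ltnS leq_addr.
Qed.

Lemma tree_amalgam_seminorm : seminorm tree_amalgam.
Proof.
split; first by rewrite /tree_amalgam (seminorm0 (amalgam_seminorm _)).
move=> u v.
have uvn : (size (u - v)%R <= maxn (size u) (size v))%N.
  by rewrite (leq_trans (size_polyD _ _)) // size_polyN.
rewrite (tree_amalgamE uvn) (tree_amalgamE (leq_maxl (size u) (size v))).
by rewrite (tree_amalgamE (leq_maxr (size u) (size v))) (seminormB (amalgam_seminorm _)).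
Qed.

Lemma tree_amalgam_monomial k x : tree_amalgam (monomial k x) = N k x.
Proof. by rewrite (tree_amalgamE (size_monomial x (ltnSn k))) amalgam_monomial. Qed.

Lemma tree_amalgam_edge n x :
  tree_amalgam (monomial n.+1 x - monomial (parent n) x) <= K n x.
Proof.
have pn := parent_le n.
rewrite (@tree_amalgamE n.+2); last first.
  rewrite (leq_trans (size_polyD _ _)) // size_polyN geq_max.
  by rewrite !size_monomial // ltnS leqW.
rewrite amalgam_stable; last first.
  rewrite (leq_trans (size_polyD _ _)) // size_polyN geq_max.
  by rewrite !size_monomial // ltnS leqW.
(* Carrying the whole coordinate [x] along the edge cancels the parent term and leaves only the cost
   [K n x]. *)
apply: le_trans (inf_convolution_le _ _ (amalgam_seminorm n) (sK n) (sN n.+1) _ x) _.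
rewrite subrK /= /coefp coefB !coef_monomial eqxx gtn_eqF ?ltnS // subr0 subrr.
rewrite (seminorm0 (sN _)) addr0 (@eq_amalgam n _ 0) => [|j jn]; last first.
  by rewrite coef_monomial coef0 ltn_eqF.
by rewrite (seminorm0 (amalgam_seminorm n)) add0r.
Qed.
End TreeAmalgam.

Lemma half_pow_small (R : realType) (C e : R) : 0 < e ->
  exists n, forall k, (n <= k)%N -> 2^-1 ^+ k * C <= e.
Proof.
move=> e0; exists (Num.truncn (`|C| / e)).+1 => k nk.
have /truncn_itv/andP[_] : 0 <= `|C| / e by rewrite divr_ge0 // ltW.
rewrite ltr_pdivrMr // => Cn; rewrite exprVn mulrC ler_pdivrMr ?exprn_gt0 //.
apply: le_trans (ler_norm C) _; apply: le_trans (ltW Cn) _.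
rewrite mulrC ler_wpM2l ?(ltW e0) // -natrX ler_nat (leq_trans nk) //.
by rewrite ltnW // ltn_expl.
Qed.

(** * The universal tree and its branches *)

Section UniversalTree.
Variables (R : realType) (D : nat -> {poly int} -> R).
Hypothesis bD : forall n, bounded_seminorm (D n).
Local Notation sqr_norm := (@sqr_norm R).

(* Node n.+1 of the tree codes a triple: its parent, the index in D of the
   seminorm that it carries, and the level k that fixes the length of the edge. *)
Definition node (n : nat) : nat * nat * nat :=
  if CodeSeq.decode n.+1 is [:: s; d; k]
  then if (s <= n)%N then (s, d, k) else (0, 0, 0)%N
  else (0, 0, 0)%N.

Definition node_parent n := (node n).1.1.
Definition node_label n := if n is m.+1 then (node m).1.2 else 0%N.

(** The prescribed length is kept only if the two seminorms are that close. The fallback 1 is always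
    admissible, because bounded seminorms differ by at most [sqr_norm]. *)
Definition edge_length n : R := let l := 2 * 2^-1 ^+ (node n).2 in
  if `[< forall x,
    `|D (node_label n.+1) x - D (node_label (node_parent n)) x| <= l * sqr_norm x >]
  then l else 1.

Lemma node_parent_le n : (node_parent n <= n)%N.
Proof.
rewrite /node_parent /node; case: (CodeSeq.decode _) => [|s [|d [|k [|]]]] //=.
by case: ifP.
Qed.

(** A code exceeds every entry of its list. Hence it is a successor [n.+1] with [s <= n], and the
    test in [node] accepts it. *)
Lemma node_surjective s d k : exists n, node n = (s, d, k).
Proof.
have := CodeSeq.codeK [:: s; d; k]; have := CodeSeq.ltn_code [:: s; d; k].
case: (CodeSeq.code _) => [|n] /and3P[sn _ _] e; first by [].
by exists n; rewrite /node e -ltnS sn.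
Qed.

Lemma edge_length_ge0 n : 0 <= edge_length n.
Proof. by rewrite /edge_length; case: ifP => _ //; rewrite mulr_ge0 // exprn_ge0. Qed.

Lemma edge_length_dist n x :
  `|D (node_label n.+1) x - D (node_label (node_parent n)) x| <= edge_length n * sqr_norm x.
Proof.
rewrite /edge_length; case: ifP => [/asboolP|_]; first exact.
by rewrite mul1r bounded_seminorm_dist.
Qed.

Lemma edge_cost_seminorm n : seminorm (fun x => edge_length n * sqr_norm x).
Proof.
have sW := wnorm_seminorm (@sqr_weight_ge0 R).
split=> [|x y]; first by rewrite [sqr_norm _](seminorm0 sW) mulr0.
by rewrite -mulrDr ler_wpM2l ?edge_length_ge0 // (seminormB sW).
Qed.

Definition universal_norm := tree_amalgam (fun n => D (node_label n))
  (fun n x => edge_length n * sqr_norm x) node_parent.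

Lemma universal_norm_seminorm : seminorm universal_norm.
Proof.
apply: tree_amalgam_seminorm => [n|n||].
- by case: (bD (node_label n)).
- exact: edge_cost_seminorm.
- exact: node_parent_le.
- exact: edge_length_dist.
Qed.

Hypothesis dense_D : forall N (e : R), bounded_seminorm N -> 0 < e ->
  exists n, forall x, `|D n x - N x| <= e * sqr_norm x.

Lemma universal_norm_branch N : bounded_seminorm N -> exists t : nat -> nat,
  forall k x, `|universal_norm (monomial (t k) x) - N x| <= 2^-1 ^+ k * sqr_norm x /\
    universal_norm (monomial (t k.+1) x - monomial (t k) x)
      <= 2 * 2^-1 ^+ k * sqr_norm x.
Proof.
move=> bN.
have label_norm n x : universal_norm (monomial n x) = D (node_label n) x.
  apply: (tree_amalgam_monomial (N := fun n => D (node_label n))) => [m|m||].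
  - by case: (bD (node_label m)).
  - exact: edge_cost_seminorm.
  - exact: node_parent_le.
  - exact: edge_length_dist.
(* The child is chosen one step more precise than its level, within 2^-(k+1). *)
have next k s : exists n, [/\ node_parent n = s, (node n).2 = k &
    forall x, `|D (node_label n.+1) x - N x| <= 2^-1 ^+ k.+1 * sqr_norm x].
  have [|d hd] := dense_D (e := 2^-1 ^+ k.+1) bN; first by rewrite exprn_gt0.
  by have [n nn] := node_surjective s d k; exists n; rewrite /node_parent /= nn.
pose child k s := projT1 (cid (next k s)).
have childP k s := projT2 (cid (next k s)).
(* The branch starts at the root, where the bound with 2^-0 = 1 holds for any bounded seminorm. The
   successor is there because [node n] describes node [n.+1]. *)
pose t := fix t k := if k is k'.+1 then (child k' (t k')).+1 else 0%N.
have tN k x : `|D (node_label (t k)) x - N x| <= 2^-1 ^+ k * sqr_norm x.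
  case: k => [|k]; first by rewrite expr0 mul1r bounded_seminorm_dist.
  by case: (childP k (t k)).
exists t => k x; split; first by rewrite label_norm.
have [pk lk _] := childP k (t k).
have -> : monomial (t k) x = monomial (node_parent (child k (t k))) x by rewrite pk.
apply: le_trans (tree_amalgam_edge _ _ _ _ _ _) _.
- by move=> m; case: (bD (node_label m)).
- exact: edge_cost_seminorm.
- exact: node_parent_le.
- exact: edge_length_dist.
rewrite ler_wpM2r ?(seminorm_ge0 (wnorm_seminorm (@sqr_weight_ge0 R))) //.
(* The labels at the two ends are within 2^-(k+1) and 2^-k of [N], so they pass the closeness test
   and the edge is short. *)
rewrite /edge_length pk lk; case: asboolP => //= -[] y.
have := ler_normD (D (node_label (t k.+1)) y - N y) (N y - D (node_label (t k)) y).
rewrite subrKA [`|N y - _|]distrC => /le_trans; apply.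
have := tN k.+1 y; have := tN k y; rewrite exprS.
have : 0 <= 2^-1 ^+ k * sqr_norm y :> R.
  by rewrite mulr_ge0 ?exprn_ge0 ?(seminorm_ge0 (wnorm_seminorm (@sqr_weight_ge0 R))).
by rewrite -!mulrA; lra.
Qed.

End UniversalTree.

(** * Extending isometrically from a dense subgroup to limits along a branch *)

Section Extension.
Variables (R : realType) (F G H : zmodType).
Variables (nG : G -> R) (nH : H -> R) (W : F -> R).
Variables (phi : {additive F -> H}) (J : nat -> {additive F -> G}).
Hypotheses (normG : is_norm nG) (normH : is_norm nH).
Hypothesis phi_dense : forall h e, 0 < e -> exists x, nH (phi x - h) <= e.
Hypothesis J_complete : forall (k : nat -> nat) (x : nat -> F),
  is_cauchy nG (fun i => J (k i) (x i)) -> exists g, forall e, 0 < e ->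
    exists n, forall i, (n <= i)%N -> nG (J (k i) (x i) - g) <= e.
Hypothesis J_norm : forall k x, `|nG (J k x) - nH (phi x)| <= 2^-1 ^+ k * W x.
Hypothesis J_step : forall k x, nG (J k.+1 x - J k x) <= 2 * 2^-1 ^+ k * W x.

Let sG : seminorm nG := normG.1.
Let sH : seminorm nH := normH.1.

Let W_ge0 x : 0 <= W x.
Proof. by have := J_norm 0 x; rewrite expr0 mul1r; exact: le_trans. Qed.

Let J_tail k n x : nG (J (k + n) x - J k x) <= 2^-1 ^+ k * (4 * W x).
Proof.
(* The telescoped geometric sum of the steps, in a form that induction can carry. *)
suff : nG (J (k + n) x - J k x) <= 4 * (2^-1 ^+ k - 2^-1 ^+ (k + n)) * W x.
  have : 0 <= 2^-1 ^+ (k + n) * W x by rewrite mulr_ge0 ?exprn_ge0.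
  lra.
elim: n => [|n IH]; first by rewrite addn0 !subrr (seminorm0 sG) mulr0 mul0r.
have := seminorm_triangle sG (J (k + n) x) (J (k + n.+1) x) (J k x).
have := J_step (k + n) x; rewrite addnS exprS; lra.
Qed.

(* g is the image of h: elements of F approximating h have images under J k
   that eventually approximate g. *)
Let represents (g : G) (h : H) := forall e, 0 < e -> exists x,
  nH (phi x - h) <= e /\ exists n, forall k, (n <= k)%N -> nG (J k x - g) <= e.

Let representsB g g' h h' :
  represents g h -> represents g' h' -> represents (g - g') (h - h').
Proof.
move=> gh gh' e e0.
have [x [xh [n xg]]] := gh (e / 2) ltac:(lra).
have [x' [xh' [n' xg']]] := gh' (e / 2) ltac:(lra).
exists (x - x'); split.
  by have := seminormB sH (phi x - h) (phi x' - h'); rewrite -subrBB -raddfB; lra.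
exists (maxn n n') => k; rewrite geq_max => /andP[/xg ? /xg' ?].
by have := seminormB sG (J k x - g) (J k x' - g'); rewrite -subrBB -raddfB; lra.
Qed.

(** Along the branch the norm of [J k x] tends to that of [phi x]. Applied to differences, this also
    makes the image of [h] unique. *)
Let represents_norm g h : represents g h -> nG g = nH h.
Proof.
move=> gh; apply/eqP; rewrite -subr_eq0 -normr_le0; apply/ler_addgt0Pr => e e0.
have [x [xh [n xg]]] := gh (e / 3) ltac:(lra).
have [m small] := half_pow_small (W x) (e := e / 3) ltac:(lra).
have := xg _ (leq_maxl n m); have := small _ (leq_maxr n m).
have := J_norm (maxn n m) x.
have := seminorm_dist sG (J (maxn n m) x) g; have := seminorm_dist sH (phi x) h.
rewrite !ler_norml => /andP[? ?] /andP[? ?] /andP[? ?] ? ?.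
by apply/andP; split; lra.
Qed.

Let represents_exists h : exists g, represents g h.
Proof.
have /choice[x xh] i : exists y, nH (phi y - h) <= 2^-1 ^+ i.
  by apply: phi_dense; rewrite exprn_gt0.
(* [k i] lies so far along the branch that the copies of [x i] have settled up to 2^-i; the diagonal
   sequence [J (k i) (x i)] is then Cauchy. *)
have /choice[k kx] i : exists m, forall j, (m <= j)%N ->
    nG (J j (x i) - J m (x i)) <= 2^-1 ^+ i.
  have [|m small] := half_pow_small (4 * W (x i)) (e := 2^-1 ^+ i).
    by rewrite exprn_gt0.
  by exists m => j /subnKC <-; apply: le_trans (J_tail _ _ _) (small _ _).
have pow_le n i : (n <= i)%N -> 2^-1 ^+ i <= 2^-1 ^+ n :> R.
  by move=> ni; rewrite ler_wiXn2l //; lra.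
have [|g gP] := @J_complete k x.
  move=> e e0; have [n small] := half_pow_small 5 e0.
  (* The 5 counts errors of size 2^-n: two from moving to the common level [j], two from comparing
     [phi (x i)] and [phi (x l)] with [h], and one from [J_norm] at level [j]. *)
  exists n => i l ni nl; apply: le_trans (small n (leqnn n)).
  have [|m mP] := half_pow_small (W (x i - x l)) (e := 2^-1 ^+ n).
    by rewrite exprn_gt0.
  pose j := maxn m (maxn (k i) (k l)).
  have [mj kij klj] : [/\ (m <= j)%N, (k i <= j)%N & (k l <= j)%N].
    by rewrite /j !leq_max !leqnn !orbT.
  have := seminorm_triangle sG (J j (x i)) (J (k i) (x i)) (J (k l) (x l)).
  have := seminorm_triangle sG (J j (x l)) (J j (x i)) (J (k l) (x l)).
  have := seminorm_triangle sH h (phi (x i)) (phi (x l)).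
  have := kx _ _ kij; have := kx _ _ klj; have := mP _ mj.
  have := J_norm j (x i - x l).
  rewrite ler_norml (raddfB phi) (raddfB (J j)) => /andP[_].
  rewrite (seminormC sG (J (k i) (x i)) (J j (x i))) (seminormC sH h).
  have := xh i; have := xh l; have := pow_le _ _ ni; have := pow_le _ _ nl.
  lra.
exists g => e e0.
have [n small] := half_pow_small 1 (e := e / 2) ltac:(lra).
have [m mP] := gP (e / 2) ltac:(lra).
pose i := maxn n m.
have := small i (leq_maxl _ _); have := mP i (leq_maxr _ _); rewrite mulr1 => h1 h2.
exists (x i); split; first by apply: le_trans (xh i) _; lra.
exists (k i) => j ij; have := kx _ _ ij.
have := seminorm_triangle sG (J (k i) (x i)) (J j (x i)) g; lra.
Qed.

Lemma isometric_extension : exists iota : {additive H -> G}, forall h, nG (iota h) = nH h.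
Proof.
pose iota h := projT1 (cid (represents_exists h)).
have iotaP h : represents (iota h) h := projT2 (cid (represents_exists h)).
have iotaB : zmod_morphism iota.
  move=> h h'; apply/eqP; rewrite -subr_eq0; apply/eqP/normG.2.
  (* The defect of additivity represents 0, hence has norm 0. *)
  rewrite (represents_norm (representsB (iotaP _) (representsB (iotaP h) (iotaP h')))).
  by rewrite subrr (seminorm0 sH).
exists (HB.pack_for {additive H -> G} iota (GRing.isZmodMorphism.Build H G iota iotaB)).
by move=> h; apply: represents_norm.
Qed.

End Extension.

(** * Norm and dense generators of a separable metric group *)

Section SeparableMetricGroup.
Variables (R : realType) (H : topologicalZmodType) (p : H -> H -> R).
Hypothesis pH : separable_invariant_metric_group p.

Definition dist_to_0 (h : H) : R := p h 0.

Lemma dist_subr x y : p x y = dist_to_0 (x - y).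
Proof. by case: pH => _ ip _; rewrite /dist_to_0 -(ip (x - y) 0 y) subrK add0r. Qed.

Lemma dist_to_0_is_norm : is_norm dist_to_0.
Proof.
case: pH => -[[p_ge0 p0 p_sym p_tri] _] _ _.
split; first split; first by rewrite /dist_to_0; apply/p0.
  by move=> x y; rewrite -dist_subr (le_trans (p_tri x 0 y)) // [p 0 y]p_sym.
by move=> x /p0.
Qed.

Lemma dense_sequence : exists s : nat -> H,
  forall h e, 0 < e -> exists i, p h (s i) <= e.
Proof.
case: pH => -[_ ip] _ [S /countable_injP[f finj] dS].
(* Numbers that are not the code of a point of [S] are sent to 0. *)
pose s i := if pselect (exists x, S x /\ f x = i) is left h then projT1 (cid h) else 0.
exists s => h e e0.
have nh : nbhs h [set z | p h z < e] by rewrite ip; exists e.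
have [x [/interior_subset /= hx Sx]] : interior [set z | p h z < e] `&` S !=set0.
  by apply: dS; [exists h; exact: nh | exact: open_interior].
exists (f x); rewrite /s; case: pselect => [hy|[]]; last by exists x.
case: (cid hy) => y [Sy yx] /=.
by rewrite (finj y x) ?inE // ltW.
Qed.

(* The i-th generator has to be within i + 1 of 0, so each point of a dense
   sequence is given arbitrarily large indices 2^j * 3^K - 1. *)
Lemma dense_generators : exists g : nat -> H,
  (forall i, p (g i) 0 <= i.+1%:R) /\
  forall h e, 0 < e -> exists i, p h (g i) <= e.
Proof.
have [s dense_s] := dense_sequence.
exists (fun i => let h := s (logn 2 i.+1) in if p h 0 <= i.+1%:R then h else 0).
split=> [i|h e e0] /=.
  by case: ifP => // _; rewrite [p 0 0](seminorm0 dist_to_0_is_norm.1).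
(* With this [K], 2^j * 3^K >= K > p (s j) 0, so the test accepts [s j] at that index; the factor
   3^K leaves the exponent [j] of 2 unchanged. *)
have [j hj] := dense_s h e e0; pose K := (Num.truncn (p (s j) 0)).+1.
exists (2 ^ j * 3 ^ K).-1.
rewrite prednK ?muln_gt0 ?expn_gt0 // lognM ?expn_gt0 // lognX lognX /=.
rewrite muln1 (_ : logn 2 3 = 0)%N // muln0 addn0.
rewrite ifT //.
have /truncn_itv/andP[_ /ltW/le_trans] : 0 <= p (s j) 0.
  exact: (seminorm_ge0 dist_to_0_is_norm.1).
apply; rewrite ler_nat -/K (leq_trans (ltnW (ltn_expl K (isT : (1 < 3)%N)))) //.
by rewrite leq_pmull // expn_gt0.
Qed.

End SeparableMetricGroup.

(** * Homomorphisms from the free abelian group Z[X] *)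

Section Combination.
Variables (H : zmodType) (g : nat -> H).

Definition combination (x : {poly int}) : H := \sum_(i < size x) g i *~ x`_i.

Lemma combinationE n (x : {poly int}) : (size x <= n)%N ->
  combination x = \sum_(i < n) g i *~ x`_i.
Proof.
move=> xn; rewrite /combination (big_ord_widen n (fun i => g i *~ x`_i) xn).
rewrite [RHS](bigID (fun i : 'I_n => (i < size x)%N)) /= [X in _ = _ + X]big1 ?addr0 //.
by move=> i; rewrite -leqNgt => /(nth_default 0) ->; rewrite mulr0z.
Qed.

Lemma combination_is_zmod_morphism : zmod_morphism combination.
Proof.
move=> x y.
have xyn : (size (x - y)%R <= maxn (size x) (size y))%N.
  by rewrite (leq_trans (size_polyD _ _)) // size_polyN.
rewrite (combinationE xyn) (combinationE (leq_maxl (size x) (size y))).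
rewrite (combinationE (leq_maxr (size x) (size y))) -sumrB.
by apply: eq_bigr => i _; rewrite coefB mulrzBr.
Qed.
HB.instance Definition _ := GRing.isZmodMorphism.Build {poly int} H combination
  combination_is_zmod_morphism.

Lemma combinationXn i : combination 'X^i = g i.
Proof.
rewrite (combinationE (eq_leq (size_polyXn _ i))) (bigD1 ord_max) //= coefXn eqxx.
rewrite big1 ?addr0 // => j ji; rewrite coefXn.
by have /negPf -> : nat_of_ord j != i by [].
Qed.

End Combination.

Section AdditiveImage.
Variables (H G : zmodType) (f : {additive H -> G}).

Definition additive_image : {pred G} := fun y => `[< exists x, f x = y >].

Lemma additive_image_zmod_closed : zmod_closed additive_image.
Proof.
split=> [|_ _ /asboolP[x <-] /asboolP[y <-]]; apply/asboolP.
  by exists 0; rewrite raddf0.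
by exists (x - y); rewrite raddfB.
Qed.
HB.instance Definition _ := GRing.isZmodClosed.Build G additive_image
  additive_image_zmod_closed.

End AdditiveImage.

(** * Universality of the completion *)

Theorem theorem0p1 (R : realType) :
  exists (G : topologicalZmodType) (d : G -> G -> R),
    separable_invariant_metric_group d /\
    (forall (H : topologicalZmodType) (p : H -> H -> R),
        separable_invariant_metric_group p ->
        exists (H' : zmodClosed G) (iota : {additive H -> G}),
          isometric_isomorphism_onto p d H' iota).
Proof.
have [D [bD dD]] := bounded_seminorms_separable R.
pose sM := universal_norm_seminorm bD.
exists (completion_space sM), (@completion_dist _ _ _ sM).
have sepG : separable_invariant_metric_group (@completion_dist _ _ _ sM).
  exact: completion_separable.
split=> // H p pH; have nH := dist_to_0_is_norm pH.
have nG := dist_to_0_is_norm sepG.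
have [g [gle gdense]] := dense_generators pH.
pose phi : {additive {poly int} -> H} := combination g.
have sN : seminorm (fun x => dist_to_0 p (phi x)).
  by split=> [|x y]; rewrite ?raddf0 ?raddfB ?(seminorm0 nH.1) ?(seminormB nH.1).
have bN : bounded_seminorm (fun x => dist_to_0 p (phi x)).
  (* The bound i + 1 on the i-th generator puts the pulled-back norm below [lin_norm]. *)
  split=> // x; apply: (seminorm_le_wnorm sN) => i.
  by rewrite /= combinationXn; apply: gle.
have [t tP] := universal_norm_branch bD dD bN.
pose J k : {additive {poly int} -> completion_space sM} :=
  to_completion sM \o monomial (t k).
have JM u : dist_to_0 (@completion_dist _ _ _ sM) (to_completion sM u) =
    universal_norm D u.
  exact: to_completion_norm.
have [||||iota iotaE] := @isometric_extension R {poly int} (completion_space sM) H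
  (dist_to_0 (@completion_dist _ _ _ sM)) (dist_to_0 p) (@sqr_norm R) phi J nG nH.
- move=> h e e0; have [i hi] := gdense h e e0.
  exists 'X^i; rewrite /= combinationXn -dist_subr //.
  by case: pH => -[[_ _ -> _] _].
- move=> k x cJ.
  (* Since [to_completion] preserves the norm, the sequence is already Cauchy before completion. *)
  have [|l lP] := @to_completion_limit _ _ _ sM (fun i => monomial (t (k i)) (x i)).
    move=> e e0; have [n hn] := cJ e e0; exists n => i m ni nm.
    by rewrite -JM raddfB; apply: hn.
  exists l => e e0; have [n hn] := lP e e0; exists n => i ni.
  by rewrite -dist_subr //; apply: hn.
- by move=> k x; rewrite /= JM; case: (tP k x).
- by move=> k x; rewrite /= -raddfB JM; case: (tP k x).
(* By invariance both distances are norms of differences, so preserving the norm is enough. *)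
have iso : isometric p (@completion_dist _ _ _ sM) iota.
  by move=> x y; rewrite (dist_subr sepG) (dist_subr pH) -raddfB iotaE.
pose H' : zmodClosed (completion_space sM) := additive_image iota.
exists H', iota; split=> //; split.
- by move=> x _; apply/asboolP; exists x.
- move=> x y _ _ xy; case: pH => -[[_ p0 _ _] _] _ _.
  case: sepG => -[[_ d0 _ _] _] _ _.
  by apply/p0; rewrite -iso; apply/d0.
- by move=> y /asboolP[x <-]; exists x.
Qed.
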